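(* Let $m\ge 0$ be an integer, let $q>1$ be real, let $q^{\mathbb{R}}=\{q^s: s\in\mathbb{R}\}$ be equipped with the forward jump operator $\sigma(t)=qt$, and let $\Lambda^2=q^{\mathbb{R}}\times q^{\mathbb{R}}$. Let $P(m,b,x)$ be the polynomial defined in the context. Then for every $t\in q^{\mathbb{R}}$, $$D_q x^{2m+1}(t)=\frac{\partial P(m,b,x)}{\Delta x}(m,\sigma(t),t)+\frac{\partial P(m,b,x)}{\Delta b}(m,t,t),$$ where $D_q f(t)=\frac{f(qt)-f(t)}{qt-t}$ is the $q$-derivative.
   Context: The polynomial $P$. Define real coefficients $\mathbf{A}_{m,r}$, $0\le r\le m$, recursively (downward in $r$) by $\mathbf{A}_{m,m}=(2m+1)\binom{2m}{m}$ and, for $0\le r<m$, $\mathbf{A}_{m,r}=(2r+1)\binom{2r}{r}\sum_{d=2r+1}^{m}\mathbf{A}_{m,d}\binom{d}{2r+1}\frac{(-1)^{d-1}}{d-r}B_{2d-2r}$, where $B_k$ are the Bernoulli numbers (an empty sum is $0$). For nonnegative integers $b$, $P(m,b,x)=\sum_{k=0}^{b-1}\sum_{r=0}^{m}\mathbf{A}_{m,r}\,k^r(x-k)^r$ with the convention $0^0=1$. This is a polynomial in $x$ and $b$, and for arbitrary real $b,x$ the symbol $P(m,b,x)$ denotes the value of the unique polynomial in $b$ and $x$ that agrees with this sum for all nonnegative integers $b$ and all real $x$. Partial derivatives with respect to the jump $\sigma$ (arguments listed in the order $(m,b,x)$): $\frac{\partial P(m,b,x)}{\Delta x}(m,c,t)=\frac{P(m,c,\sigma(t))-P(m,c,t)}{\sigma(t)-t}$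 and $\frac{\partial P(m,b,x)}{\Delta b}(m,t,c)=\frac{P(m,\sigma(t),c)-P(m,t,c)}{\sigma(t)-t}$. *)

(* Defs.v *)
From HB Require Import structures.
From mathcomp Require Import all_boot all_order all_algebra.
From mathcomp Require Import all_classical all_reals all_analysis.

Set Implicit Arguments.
Unset Strict Implicit.
Unset Printing Implicit Defensive.

Import Order.TTheory GRing.Theory Num.Theory.

Local Open Scope classical_set_scope.
Local Open Scope ring_scope.

Section BernoulliNumbers.
Variable R : realType.

(* [:: B_0; ...; B_(n-1)], from B_0 = 1 and \sum_(j <= n) 'C(n+1, j) B_j = 0
   for n > 0.  The resulting convention is B_1 = -1/2. *)
Fixpoint bernoulli_seq (n : nat) : seq R :=
  if n is n'.+1 then
    let s := bernoulli_seq n' in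
    rcons s (if n' == 0%N then 1
             else - (n'.+1%:R)^-1 * \sum_(j < n') 'C(n'.+1, j)%:R * s`_j)
  else [::].

Definition bernoulli_number (n : nat) : R := (bernoulli_seq n.+1)`_n.

Lemma size_bernoulli_seq n : size (bernoulli_seq n) = n.
Proof. by elim: n => //= n IH; rewrite size_rcons IH. Qed.

Lemma nth_bernoulli_seq n j : (j < n)%N ->
  (bernoulli_seq n)`_j = bernoulli_number j.
Proof.
elim: n => // n IH; rewrite ltnS leq_eqVlt => /orP[/eqP -> //|jn].
by rewrite /= nth_rcons size_bernoulli_seq jn IH.
Qed.

Lemma bernoulli_number0 : bernoulli_number 0 = 1.
Proof. by []. Qed.

Lemma bernoulli_number_rec n : (0 < n)%N ->
  \sum_(j < n.+1) 'C(n.+1, j)%:R * bernoulli_number j = 0.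
Proof.
move=> n0; rewrite big_ord_recr /= binSn.
rewrite [X in _ + _ * X]/bernoulli_number /= nth_rcons size_bernoulli_seq.
rewrite ltnn eqxx (negbTE (lt0n_neq0 n0)) mulrA mulrN mulfV ?pnatr_eq0 //.
rewrite mulN1r; apply/eqP; rewrite subr_eq0; apply/eqP/eq_bigr => j _.
by rewrite nth_bernoulli_seq.
Qed.

End BernoulliNumbers.

Section PolynomialP.
Variable R : realType.

(* The recursion is downward in r, and m - r bounds its depth; [coefA_top] and
   [coefA_rec] are the defining equations. *)
Fixpoint coefA_fuel (m n r : nat) : R :=
  if r == m then ((2 * m).+1 * 'C(2 * m, m))%:R
  else if n is n'.+1 then
    ((2 * r).+1 * 'C(2 * r, r))%:R *
    \sum_((2 * r).+1 <= d < m.+1)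
       coefA_fuel m n' d * 'C(d, (2 * r).+1)%:R *
       ((-1) ^+ d.-1 / (d - r)%:R) * bernoulli_number R (2 * d - 2 * r)
  else 0.

Definition coefA (m r : nat) : R := coefA_fuel m (m - r) r.

Lemma coefA_fuelE m n r : (r <= m)%N -> (m - r <= n)%N ->
  coefA_fuel m n r = coefA m r.
Proof.
suff H k : forall n n' r, (r <= m)%N -> (m - r <= k)%N -> (m - r <= n)%N ->
    (m - r <= n')%N -> coefA_fuel m n r = coefA_fuel m n' r.
  by move=> rm rn; apply: (H (m - r)%N).
elim: k => [|k IH] {}n n' {}r rm.
  rewrite leqn0 subn_eq0 => mr.
  have -> : r = m by apply/eqP; rewrite eqn_leq rm mr.
  by case: n; case: n' => *; rewrite /= eqxx.
move=> rk; have [->|rNm] := eqVneq r m.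
  by case: n; case: n' => *; rewrite /= eqxx.
have mr0 : (0 < m - r)%N by rewrite subn_gt0 ltn_neqAle rNm rm.
case: n n' => [|n] [|n'] nr n'r; do ?by move: mr0; rewrite ltnNge ?nr ?n'r.
rewrite /= (negbTE rNm); congr (_ * _); apply: eq_big_nat => d /andP[rd dm].
have rd' : (r < d)%N by apply: leq_trans rd; rewrite ltnS leq_pmull.
have mdr : (m - d < m - r)%N.
  by apply: ltn_sub2l => //; rewrite ltn_neqAle rNm rm.
rewrite (IH n n' d) //; by rewrite -ltnS; apply: leq_trans mdr _.
Qed.

Lemma coefA_top m : coefA m m = ((2 * m).+1 * 'C(2 * m, m))%:R.
Proof. by rewrite /coefA subnn /= eqxx. Qed.

Lemma coefA_rec m r : (r < m)%N ->
  coefA m r = ((2 * r).+1 * 'C(2 * r, r))%:R *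
    \sum_((2 * r).+1 <= d < m.+1)
       coefA m d * 'C(d, (2 * r).+1)%:R *
       ((-1) ^+ d.-1 / (d - r)%:R) * bernoulli_number R (2 * d - 2 * r).
Proof.
move=> rm; rewrite -(@coefA_fuelE m (m - r).+1 r) ?leqnSn ?(ltnW rm) //=.
rewrite (ltn_eqF rm); congr (_ * _); apply: eq_big_nat => d /andP[rd dm].
have rd' : (r <= d)%N.
  by apply: leq_trans rd; apply: ltnW; rewrite ltnS leq_pmull.
by rewrite coefA_fuelE //; apply: leq_sub2l.
Qed.

(* x ^+ 0 = 1 for every x, including 0. *)
Definition sumP (m b : nat) (x : R) : R :=
  \sum_(k < b) \sum_(r < m.+1) coefA m r * k%:R ^+ r * (x - k%:R) ^+ r.

(* A polynomial in b and x is an element of {poly {poly R}} whose outer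
   variable is b and whose inner variable is x. *)
Definition interpolatesP (m : nat) (p : {poly {poly R}}) : Prop :=
  forall (b : nat) (x : R), p.[(b%:R)%:P].[x] = sumP m b x.

Lemma power_sum_poly n : exists s : {poly {poly R}},
  forall b : nat, s.[b%:R] = \sum_(k < b) (k%:R : {poly R}) ^+ n.
Proof.
elim/ltn_ind: n => n IH.
have /choice[s sP] : forall j : 'I_n, exists s : {poly {poly R}},
    forall b : nat, s.[b%:R] = \sum_(k < b) (k%:R : {poly R}) ^+ j.
  by move=> j; apply: IH.
have n1U : ((n.+1%:R)^-1 : R)%:P * n.+1%:R = 1 :> {poly R}.
  by rewrite -polyC_natr -polyCM mulVf ?pnatr_eq0.
exists (((n.+1%:R)^-1)%:P%:P *
  ('X^(n.+1) - \sum_(j < n) ('C(n.+1, j)%:R)%:P * s j)) => b.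
rewrite hornerM hornerC hornerD hornerN hornerXn horner_sum.
have -> : (b%:R : {poly R}) ^+ n.+1 =
    \sum_(k < b) \sum_(j < n.+1) ((k%:R : {poly R}) ^+ j) *+ 'C(n.+1, j).
  elim: b => [|b IHb]; first by rewrite big_ord0 expr0n.
  rewrite big_ord_recr /= -IHb -[in LHS]natr1 [_ + 1]addrC exprDn.
  rewrite big_ord_recr /= expr1n mul1r binn mulr1n addrC.
  by congr (_ + _); apply: eq_bigr => j _; rewrite expr1n mul1r.
rewrite exchange_big /= big_ord_recr /= binSn.
under [X in _ - X]eq_bigr => j _ do
  rewrite hornerM hornerC sP mulr_natl -sumrMnl.
rewrite [X in _ * (X - _)]addrC addrK sumrMnl.
by rewrite -[X in _ * X]mulr_natl mulrA n1U mul1r.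
Qed.

Lemma sum_poly (q : {poly {poly R}}) : exists s : {poly {poly R}},
  forall b : nat, s.[b%:R] = \sum_(k < b) q.[k%:R].
Proof.
have /choice[s sP] := power_sum_poly.
exists (\sum_(i < size q) (q`_i)%:P * s i) => b.
rewrite horner_sum; under eq_bigr do rewrite hornerM hornerC sP mulr_sumr.
by rewrite exchange_big; apply: eq_bigr => k _; rewrite horner_coef.
Qed.

Lemma interpolatesP_exists m : exists p, interpolatesP m p.
Proof.
have [s sP] := sum_poly
  (\sum_(r < m.+1) (coefA m r)%:P%:P * 'X^r * ('X%:P - 'X) ^+ r).
exists s => b x; rewrite polyC_natr sP /sumP horner_sum.
apply: eq_bigr => k _; rewrite !horner_sum; apply: eq_bigr => r _.
by rewrite -polyC_natr !(hornerE, hornerXn, horner_exp).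
Qed.

Lemma poly_natr_eq0 (S : idomainType) (p : {poly S}) :
  injective (fun n : nat => n%:R : S) ->
  (forall n : nat, p.[n%:R] = 0) -> p = 0.
Proof.
move=> injS p0; apply: (@roots_geq_poly_eq0 _ _ [seq n%:R | n <- iota 0 (size p)]).
- by apply/allP => _ /mapP[n _ ->]; rewrite /root p0.
- by rewrite map_inj_uniq ?iota_uniq.
- by rewrite size_map size_iota.
Qed.

Lemma interpolatesP_unique m p1 p2 :
  interpolatesP m p1 -> interpolatesP m p2 -> p1 = p2.
Proof.
move=> p1P p2P; apply/eqP; rewrite -subr_eq0; apply/eqP.
have injR : injective (fun n : nat => n%:R : R) by exact: mulrIn (oner_neq0 R).
apply: poly_natr_eq0 => [i j|b].
  by rewrite -2!polyC_natr => /polyC_inj; exact: injR.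
apply: poly_natr_eq0 => // n.
by rewrite -polyC_natr !hornerE p1P p2P subrr.
Qed.

Definition polyP (m : nat) : {poly {poly R}} :=
  projT1 (cid (interpolatesP_exists m)).

Lemma polyP_nat m : interpolatesP m (polyP m).
Proof. exact: projT2 (cid (interpolatesP_exists m)). Qed.

Definition P (m : nat) (b x : R) : R := (polyP m).[b%:P].[x].

End PolynomialP.

Section TimeScale.
Variable R : realType.

Definition qR (q : R) : set R := [set q `^ s | s in [set: R]].

Definition qjump (q t : R) : R := q * t.

Definition q_derivative (q : R) (f : R -> R) (t : R) : R :=
  (f (q * t) - f t) / (q * t - t).

Definition partial_Dx (sigma : R -> R) (F : nat -> R -> R -> R)
    (m : nat) (c t : R) : R :=
  (F m c (sigma t) - F m c t) / (sigma t - t).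

Definition partial_Db (sigma : R -> R) (F : nat -> R -> R -> R)
    (m : nat) (t c : R) : R :=
  (F m (sigma t) c - F m t c) / (sigma t - t).

End TimeScale.

(* Main.v *)
Require Import Defs.
From HB Require Import structures.
From mathcomp Require Import all_boot all_order all_algebra.
From mathcomp Require Import all_classical all_reals all_analysis.
From mathcomp Require Import ring zify.

Import Order.TTheory GRing.Theory Num.Theory.

Local Open Scope classical_set_scope.
Local Open Scope ring_scope.

(** Adding the two difference quotients cancels P(m, qt, t), so that the
    statement becomes P(m, qt, qt) - P(m, t, t) = (qt)^(2m+1) - t^(2m+1).  It
    therefore follows from the diagonal identity P(m, x, x) = x^(2m+1)
    ([P_diag]), which holds for every real x as soon as it holds for the
    natural numbers, both sides being polynomials in x.

    For x = n natural, P(m, n, n) is the combination with coefficients A_(m,r)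
    of the convolved power sums S_r(n) = \sum_(k < n) k^r (n - k)^r.  The
    recursion for A_(m,r) is tailored to the closed form
    [convolved_power_sum]
      S_r(n) = n^(2r+1) / ((2r+1) binom(2r, r))
        + (-1)^r \sum_i binom(r, 2i+1) n^(2i+1) B_(2r-2i) / (r - i):
    the coefficient of n^(2i+1) in \sum_r A_(m,r) S_r(n) is zero for i < m by
    the equation that defines A_(m,i), and is one for i = m.

    The closed form is obtained umbrally.  Let L be the linear functional on
    polynomials with L(X^i) = B_i.  The recurrence of the Bernoulli numbers says
    L(f(X + 1)) = L(f) + f'(0), so that a sum telescopes as
    \sum_(k < n) F'(k) = L(F(X + n)) - L(F).  Take F with
    F' = X^r (c - X)^r and G with G' = X^r (X + c)^r, where c = n and both
    primitives vanish at 0.  The reflection X -> - X and the shift X -> X + c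
    both carry F' to (-1)^r G', so that F = - (-1)^r G(- X) and
    F(X + c) = F(c) + (-1)^r G, hence
    S_r(n) = F(n) + (-1)^r (L(G) + L(G(- X))).
    Here F(n) is a Beta integral, and symmetrizing G kills its odd powers of X,
    which leaves only Bernoulli numbers of even index. *)

(** * The umbral functional of the Bernoulli numbers *)

Section UmbralFunctional.
Variable R : realType.
Implicit Types (p f F : {poly R}) (n : nat).

Definition umbral p : R := \sum_(i < size p) p`_i * bernoulli_number R i.

(** The bound [size p] in [umbral] depends on p; a common bound is what makes
    the linearity of [umbral] visible. *)
Lemma umbral_wide N p : (size p <= N)%N ->
  umbral p = \sum_(i < N) p`_i * bernoulli_number R i.
Proof.
move=> pN; rewrite /umbral.
rewrite (big_ord_widen N (fun i => p`_i * bernoulli_number R i)) //.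
rewrite big_mkcond; apply: eq_bigr => i _.
by case: ltnP => // ?; rewrite nth_default ?mul0r.
Qed.

Lemma umbral_is_linear : linear umbral.
Proof.
move=> a p q; pose N := maxn (size p) (size q).
have pN : (size p <= N)%N by rewrite leq_maxl.
have qN : (size q <= N)%N by rewrite leq_maxr.
have sN : (size (a *: p + q)%R <= N)%N.
  rewrite (leq_trans (size_polyD _ _)) // geq_max qN.
  by rewrite (leq_trans (size_scale_leq _ _)).
rewrite !(@umbral_wide N) // /GRing.scale /= mulr_sumr -big_split /=.
by apply: eq_bigr => i _; rewrite coefD coefZ mulrDl mulrA.
Qed.

HB.instance Definition _ :=
  GRing.isLinear.Build R {poly R} R _ umbral umbral_is_linear.

Lemma umbralXn n : umbral 'X^n = bernoulli_number R n.
Proof.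
rewrite /umbral size_polyXn big_ord_recr /= coefXn eqxx mul1r.
rewrite big1 ?add0r // => i _.
by rewrite coefXn (ltn_eqF (ltn_ord i)) mul0r.
Qed.

Lemma umbralC c : umbral c%:P = c.
Proof.
rewrite -alg_polyC -(expr0 'X) linearZ /= umbralXn bernoulli_number0.
by rewrite /GRing.scale /= mulr1.
Qed.

(** On X^i this is the recurrence of the Bernoulli numbers: expanding (X + 1)^i
    leaves \sum_(j < i) binom(i, j) B_j besides B_i, which is 0 unless i = 1. *)
Lemma umbral_shift1 f : umbral (f \Po ('X + 1)) = umbral f + f^`().[0].
Proof.
have mono i : umbral ('X^i \Po ('X + 1)) = umbral 'X^i + ('X^i : {poly R})^`().[0].
  rewrite comp_Xn_poly exprDn linear_sum /=.
  under eq_bigr => j _ do rewrite expr1n mulr1 linearMn /= umbralXn.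
  rewrite (reindex_inj rev_ord_inj) /= big_ord_recr /= umbralXn addrC.
  rewrite subSS subnn subn0 bin0 mulr1n derivXn; congr (_ + _).
  case: i => [|[|i]].
  - by rewrite big_ord0 mulr0n horner0.
  - by rewrite big_ord1 subnn bin1 mulr1n expr0 hornerC.
  - rewrite hornerMn hornerXn expr0n mul0rn.
    rewrite -[RHS](@bernoulli_number_rec R i.+1) //; apply: eq_bigr => j _.
    have ji : (j <= i.+2)%N by rewrite ltnW.
    by rewrite subSS subKn // bin_sub // mulr_natl.
rewrite -[f]coefK poly_def !linear_sum /= horner_sum -big_split /=.
apply: eq_bigr => i _.
by rewrite derivZ comp_polyZ hornerZ !linearZ /= mono -scalerDr.
Qed.

(** Euler-Maclaurin summation in its exact, polynomial form. *)
Lemma sum_deriv_umbral F n :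
  \sum_(k < n) F^`().[k%:R] = umbral (F \Po ('X + n%:R%:P)) - umbral F.
Proof.
elim: n => [|n IH]; first by rewrite big_ord0 addr0 comp_polyXr subrr.
rewrite big_ord_recr /= IH.
have -> : F \Po ('X + n.+1%:R%:P) = (F \Po ('X + n%:R%:P)) \Po ('X + 1).
  rewrite -comp_polyA comp_polyD comp_polyX comp_polyC; congr (_ \Po _).
  by rewrite -addrA -natr1 polyCD [1 + _]addrC.
rewrite umbral_shift1 deriv_comp hornerM horner_comp derivD derivX derivC.
by rewrite !hornerE /= addrAC.
Qed.

End UmbralFunctional.

(** * The value of the Beta integral *)

Section BetaIntegral.
Variable R : realType.

(** The left-hand side is the integral of x^a (1 - x)^r over [0, 1]; Pascal's
    rule mirrors (1 - x)^(r+1) = (1 - x)^r - x (1 - x)^r, which gives the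
    induction on r with a varying. *)
Lemma alt_sum_bin_inv r a :
  \sum_(j < r.+1) (-1) ^+ j * 'C(r, j)%:R / (a + j).+1%:R =
  (a`! * r`!)%:R / (a + r).+1`!%:R :> R.
Proof.
elim: r a => [|r IH] a.
  rewrite big_ord1 expr0 bin0 !addn0 muln1 !mul1r factS natrM invfM.
  by rewrite mulrCA mulfV ?mulr1 // pnatr_eq0 -lt0n fact_gt0.
pose u s j : R := (-1) ^+ j * 'C(s, j)%:R / (a + j).+1%:R.
have -> : \sum_(j < r.+2) (-1) ^+ j * 'C(r.+1, j)%:R / (a + j).+1%:R =
    \sum_(j < r.+1) (-1) ^+ j * 'C(r, j)%:R / (a + j).+1%:R -
    \sum_(j < r.+1) (-1) ^+ j * 'C(r, j)%:R / (a.+1 + j).+1%:R :> R.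
  rewrite big_ord_recl /= [X in _ = X - _](_ : _ = \sum_(j < r.+2) u r j); last first.
    by rewrite [RHS]big_ord_recr /= /u bin_small // mulr0 mul0r addr0.
  rewrite [X in _ = X - _]big_ord_recl /= !bin0 -addrA; congr (_ + _).
    by rewrite /u bin0.
  rewrite -sumrB; apply: eq_bigr => j _; rewrite /u /bump /= add1n binS natrD exprS.
  by rewrite addSn addnS; ring.
rewrite !IH addnS addSn !factS !natrM.
have a1 : (a + r).+2%:R != 0 :> R by rewrite pnatr_eq0.
have a2 : (a + r).+1%:R != 0 :> R by rewrite pnatr_eq0.
have a3 : (a + r)`!%:R != 0 :> R by rewrite pnatr_eq0 -lt0n fact_gt0.
move: a1 a2 a3; rewrite -!natr1 !natrD => a1 a2 a3; field.
by rewrite a1 a2 a3.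
Qed.

(** The reciprocal of the leading coefficient A_(r,r). *)
Lemma beta_diag r :
  \sum_(j < r.+1) (-1) ^+ j * 'C(r, j)%:R / (r + j).+1%:R =
  ((2 * r).+1 * 'C(2 * r, r))%:R^-1 :> R.
Proof.
rewrite alt_sum_bin_inv addnn -mul2n factS.
have e : ('C(2 * r, r) * (r`! * r`!) = (2 * r)`!)%N.
  by rewrite -(@bin_fact (2 * r) r) ?leq_pmull // mul2n -addnn addnK.
have w0 : (r`! * r`!)%:R != 0 :> R.
  by rewrite pnatr_eq0 muln_eq0 negb_or -!lt0n fact_gt0.
rewrite -e mulnA; move: (r`! * r`!)%N w0 => w w0.
by rewrite [in LHS]natrM invfM mulrCA mulfV ?mulr1.
Qed.

End BetaIntegral.

Lemma deriv0_const {R : realType} (p : {poly R}) : p^`() = 0 -> p = p.[0]%:P.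
Proof.
move=> p0; apply/polyP => -[|i]; rewrite coefC /= ?horner_coef0 //.
have := congr1 (fun q : {poly R} => q`_i) p0; rewrite coef_deriv coef0.
by move/eqP; rewrite mulrn_eq0 /= => /eqP.
Qed.

(** * Primitives of X^r (X + c)^r and X^r (c - X)^r *)

Section Primitives.
Variables (R : realType) (r : nat) (c : R).

(** The primitive of X^r (X + c)^r that vanishes at 0, written so that its
    coefficients come with increasing powers of c. *)
Definition primP : {poly R} :=
  \sum_(e < r.+1) ('C(r, e)%:R * c ^+ e / (2 * r - e).+1%:R) *: 'X^((2 * r - e).+1).

Lemma deriv_primP : primP^`() = 'X^r * ('X + c%:P) ^+ r.
Proof.
rewrite exprDn mulr_sumr /primP linear_sum /=; apply: eq_bigr => e _.
rewrite derivZ derivXn /= -[X in _ *: X]scaler_nat scalerA divfK ?pnatr_eq0 //.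
rewrite mulrnAr mulrA -exprD -polyC_exp [_ * _%:P]mulrC mul_polyC -[RHS]scaler_nat.
by rewrite scalerA addnBA ?addnn ?mul2n // -ltnS.
Qed.

(** Defined through [primP], so that the reflection X -> - X exchanging the two
    primitives holds by definition. *)
Definition primM : {poly R} := - (-1) ^+ r *: (primP \Po (- 'X)).

Lemma deriv_primM : primM^`() = 'X^r * (c%:P - 'X) ^+ r.
Proof.
rewrite /primM derivZ deriv_comp deriv_primP derivN derivX mulrN1 scaleNr scalerN opprK.
rewrite comp_polyM comp_Xn_poly rmorphXn /= comp_polyD comp_polyX comp_polyC.
rewrite [- 'X + _]addrC [(- 'X) ^+ r]exprNn -[in LHS]mulrA.
by rewrite -mul_polyC polyC_exp polyCN signrMK.
Qed.

(** The derivative of the left-hand side is (X + c)^r (- X)^r, that is,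
    (-1)^r times the derivative of [primP]; the constant is found at 0. *)
Lemma primM_shift : primM \Po ('X + c%:P) = (primM.[c])%:P + (-1) ^+ r *: primP.
Proof.
apply/eqP; rewrite -subr_eq; apply/eqP.
rewrite [LHS]deriv0_const.
  rewrite hornerD hornerN horner_comp (hornerZ _ primP).
  have -> : primP.[0] = 0.
    by rewrite horner_sum big1 // => e _; rewrite hornerZ hornerXn expr0n mulr0.
  by rewrite !(hornerD, hornerX, hornerC) add0r mulr0 subr0.
rewrite derivB deriv_comp deriv_primM derivZ deriv_primP derivD derivX derivC addr0 mulr1.
rewrite comp_polyM comp_Xn_poly rmorphXn /= comp_polyB comp_polyX comp_polyC.
by rewrite opprD addrCA subrr addr0 [(- 'X) ^+ r]exprNn -mul_polyC polyC_exp polyCN; ring.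
Qed.

Lemma primM_at : primM.[c] = c ^+ (2 * r).+1 / ((2 * r).+1 * 'C(2 * r, r))%:R.
Proof.
rewrite -beta_diag /primM hornerZ horner_comp hornerN hornerX horner_sum.
rewrite !mulr_sumr (reindex_inj rev_ord_inj) /=; apply: eq_bigr => j _.
have jr : (j <= r)%N by rewrite -ltnS.
rewrite subSS bin_sub // hornerZ hornerXn.
have -> : (2 * r - (r - j) = r + j)%N by lia.
have -> : (2 * r).+1 = ((r - j) + (r + j).+1)%N by lia.
rewrite [(- c) ^+ _]exprNn !exprD exprS exprD.
(* The signs (-1)^r from the prefactor, from the reversal of the sum and from
   the reflection have to be collected before they cancel. *)
have := signrMK r (1 : R).
rewrite mulr1 => s; move: (_.+1%:R^-1) => w.
transitivity (((-1) ^+ r * (-1) ^+ r : R) *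
  ((-1) ^+ j * 'C(r,j)%:R * c ^+ (r - j) * w * c ^+ (r + j).+1)).
  ring.
by rewrite s; ring.
Qed.

End Primitives.

(** * Convolved power sums *)

Lemma sum_double_odd {R : realType} N (f : nat -> R) : (forall i, f (2 * i)%N = 0) ->
  \sum_(e < 2 * N) f e = \sum_(i < N) f (2 * i).+1.
Proof.
move=> f0; elim: N => [|N IH]; first by rewrite !big_ord0.
by rewrite mulnSr addn2 !big_ord_recr /= IH f0 addr0.
Qed.

Section ConvolvedPowerSums.
Variable R : realType.

(** The reflection X -> - X cancels the odd powers of X and doubles the even
    ones, and the factor 2 turns 1 / (2r - 2i) into 1 / (r - i).  The upper
    bound N is free because binom(r, 2i+1) = 0 beyond r; this allows a bound
    that is common to all r <= m. *)
Lemma umbral_primP_even r (c : R) N : (r < 2 * N)%N ->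
  umbral R (primP R r c) + umbral R (primP R r c \Po - 'X) =
  \sum_(i < N) 'C(r, (2 * i).+1)%:R * c ^+ (2 * i).+1 / (r - i)%:R *
     bernoulli_number R (2 * r - 2 * i).
Proof.
move=> rN.
(* The term of degree 2r - e + 1, which survives only for odd e. *)
pose f e : R := 'C(r, e)%:R * c ^+ e / (2 * r - e).+1%:R *
  ((1 + (-1) ^+ (2 * r - e).+1) * bernoulli_number R (2 * r - e).+1).
transitivity (\sum_(e < 2 * N) f e).
  transitivity (\sum_(e < r.+1) f e); last first.
    rewrite (big_ord_widen _ _ rN) big_mkcond; apply: eq_bigr => e _ /=.
    by case: ltnP => // re; rewrite /f bin_small ?mul0r.
  rewrite [X in X \Po _]/primP linear_sum /= /primP !linear_sum /= -big_split /=.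
  apply: eq_bigr => e _; rewrite comp_polyZ comp_Xn_poly !linearZ /=.
  have -> k : (- 'X) ^+ k = (-1) ^+ k *: 'X^k :> {poly R}.
    by rewrite -mul_polyC polyC_exp polyCN exprNn.
  by rewrite linearZ /= umbralXn /f /GRing.scale /=; ring.
rewrite sum_double_odd => [|i].
  apply: eq_bigr => i _; rewrite /f; have [ir|ri] := leqP (2 * i).+1 r; last first.
    by rewrite bin_small // !mul0r.
  have -> : (2 * r - (2 * i).+1).+1 = (2 * r - 2 * i)%N by lia.
  rewrite -mulnBr exprM sqrrN !expr1n natrM.
  have : (r - i)%:R != 0 :> R by rewrite pnatr_eq0 subn_eq0; lia.
  by move: (r - i)%:R => x x0; field.
rewrite /f; have [ir|ri] := leqP (2 * i) r; last by rewrite bin_small // !mul0r.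
by rewrite -mulnBr exprS [(-1) ^+ (2 * _)]exprM sqrrN !expr1n mulr1 subrr mul0r mulr0.
Qed.

(** In the telescoped sum, shift and reflection turn both umbral values into
    values on [primP], whose symmetrization is all that remains besides the
    Beta integral. *)
Lemma convolved_power_sum r n N : (r < 2 * N)%N ->
  \sum_(k < n) k%:R ^+ r * (n%:R - k%:R) ^+ r =
  n%:R ^+ (2 * r).+1 / ((2 * r).+1 * 'C(2 * r, r))%:R +
  (-1) ^+ r * \sum_(i < N) 'C(r, (2 * i).+1)%:R * n%:R ^+ (2 * i).+1 /
     (r - i)%:R * bernoulli_number R (2 * r - 2 * i).
Proof.
move=> rN; rewrite -(umbral_primP_even r n%:R N rN).
transitivity (\sum_(k < n) (primM R r n%:R)^`().[k%:R]).
  by apply: eq_bigr => k _; rewrite deriv_primM hornerM hornerXn horner_exp !hornerE.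
rewrite sum_deriv_umbral primM_shift linearD /= linearZ /= umbralC primM_at.
by rewrite /primM linearZ /= /GRing.scale /= mulrDr mulNr opprK addrA.
Qed.

End ConvolvedPowerSums.

(** * The diagonal of P *)

Section Diagonal.
Variable R : realType.

Lemma sumP_diag m n : sumP m n n%:R = n%:R ^+ (2 * m).+1 :> R.
Proof.
(* A_(m,d) / D d and A_(m,d) (-1)^d T d i are the contributions of S_d(n) to
   the coefficients of n^(2d+1) and n^(2i+1). *)
pose D i : R := ((2 * i).+1 * 'C(2 * i, i))%:R.
pose T d i : R := 'C(d, (2 * i).+1)%:R / (d - i)%:R * bernoulli_number R (2 * d - 2 * i).
have -> : sumP m n n%:R = \sum_(i < m.+1) n%:R ^+ (2 * i).+1 *
    (coefA R m i / D i + \sum_(d < m.+1) coefA R m d * (-1) ^+ d * T d i).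
  rewrite /sumP exchange_big /=.
  under [RHS]eq_bigr => i _ do rewrite mulrDr mulr_sumr.
  rewrite big_split /= [X in _ = _ + X]exchange_big /= -big_split /=.
  apply: eq_bigr => d _.
  under eq_bigr => k _ do rewrite -mulrA.
  rewrite -mulr_sumr (convolved_power_sum R d n m.+1); last by have := ltn_ord d; lia.
  rewrite mulrDr; congr (_ + _); first by rewrite mulrCA.
  by rewrite mulrA mulr_sumr; apply: eq_bigr => i _; rewrite /T; ring.
have D0 i : D i != 0.
  by rewrite pnatr_eq0 muln_eq0 /= -lt0n bin_gt0 leq_pmull.
rewrite big_ord_recr /= big1 ?add0r => [|i _].
  rewrite coefA_top mulfV ?D0 // big1 ?addr0 ?mulr1 // => d _.
  by rewrite /T bin_small ?mul0r ?mulr0 //; have := ltn_ord d; lia.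
(* For i < m, D i cancels against the leading factor of the recursion, and the
   two sums over d are opposite because (-1)^d = - (-1)^(d-1) for d > 0. *)
rewrite coefA_rec // mulrAC mulfV ?D0 // mul1r.
rewrite (big_nat_widenl _ 0) // big_mkord big_mkcond -big_split /= big1 ?mulr0 // => d _.
case: ltnP => id; last by rewrite /T bin_small // !mul0r mulr0 addr0.
by case: d id => -[|d] //= _ _; rewrite /T exprS; ring.
Qed.

(** Substituting X for b turns the two-variable polynomial into a polynomial in
    x, which agrees with x^(2m+1) at every natural number. *)
Lemma P_diag m (x : R) : P m x x = x ^+ (2 * m).+1.
Proof.
have diagE y : (Defs.polyP R m).['X].[y] = P m y y.
  rewrite /P !(horner_coef (Defs.polyP R m)) !horner_sum; apply: eq_bigr => i _.
  by rewrite !hornerM !horner_exp hornerX hornerC.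
suff /eqP : (Defs.polyP R m).['X] - 'X^((2 * m).+1) = 0.
  by rewrite subr_eq0 -diagE => /eqP ->; rewrite hornerXn.
apply: poly_natr_eq0 => [|n]; first exact: mulrIn (oner_neq0 R).
by rewrite hornerD hornerN hornerXn diagE /P polyP_nat sumP_diag subrr.
Qed.

End Diagonal.

Theorem corollary4p9 (R : realType) (m : nat) (q : R) (hq : 1 < q)
    (t : R) (ht : qR q t) :
  q_derivative q (fun x : R => x ^+ (2 * m + 1)) t =
  partial_Dx (qjump q) (@P R) m (qjump q t) t
  + partial_Db (qjump q) (@P R) m t t.
Proof.
by rewrite /q_derivative /partial_Dx /partial_Db /qjump -mulrDl subrKA
  !P_diag addn1.
Qed.
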